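(* Let $l^-,r^-,l^+,r^+\ge0$ be integers with $l^--r^-\in\{1,2\}$ and $r^+-l^+\in\{1,2\}$, let $q\ge1$ and $N\ge1$ be integers, let $\mathcal{D}_x^-$ and $\mathcal{D}_x^+$ be the optimally accurate first-derivative finite-difference operators with stencils $(l^-,r^-)$ and $(l^+,r^+)$ respectively, and let $\mathcal{D}_{xx}$ be the optimally accurate second-derivative finite-difference operator with centered stencil $q$, with corresponding $N\times N$ circulant matrices $\boldsymbol{A}^-,\boldsymbol{A}^+,\boldsymbol{B}$. Then the $2N\times2N$ matrix $$\boldsymbol{M}=-\frac12\begin{bmatrix}\boldsymbol{A}^--\boldsymbol{A}^+&\boldsymbol{A}^-+\boldsymbol{A}^+\\ \boldsymbol{A}^-+\boldsymbol{A}^+&\boldsymbol{A}^--\boldsymbol{A}^+\end{bmatrix}+R\begin{bmatrix}\boldsymbol{B}&\boldsymbol{0}\\ \boldsymbol{0}&\boldsymbol{0}\end{bmatrix}$$ is semistable for all $R>0$.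
   Context: The matrix arises from the semi-discretization of the partially dissipative wave system $v_t+p_x-\nu v_{xx}=0$, $p_t+v_x=0$ (periodic on $[0,1]$, $N$ uniform cells, $h=1/N$, $R=\nu/h$), in which $\mathcal{D}_x^-$ is applied to $v+p$ and $\mathcal{D}_x^+$ to $v-p$. For a stencil $(l,r)$, the optimally accurate first-derivative operator is $\mathcal{D}_xw_j=\frac1h\sum_{k=-l}^r a_kw_{j+k}$ with $$a_k=-\frac{(-1)^k}{k}\frac{l!\,r!}{(l+k)!\,(r-k)!}\ (-l\le k\le r,\ k\neq0),\qquad a_0=-\sum_{-l\le k\le r,\,k\ne0}\frac1k.$$ Denote by $a_k^-$ these coefficients for $(l,r)=(l^-,r^-)$ and by $a_k^+$ those for $(l,r)=(l^+,r^+)$. The optimally accurate second-derivative operator is $\mathcal{D}_{xx}w_j=\frac1{h^2}\sum_{k=-q}^q b_kw_{j+k}$ with $$b_k=-\frac{2(-1)^k}{k^2}\frac{q!\,q!}{(q+k)!\,(q-k)!}\ (k\ne0),\qquad b_0=-\sum_{k=1}^q\frac{2}{k^2}.$$ With $\boldsymbol{S}$ the $N\times N$ cyclic shift matrix, $(\boldsymbol{S}\boldsymbol{W})_j=w_{j+1}$ (indices modulo $N$), $\boldsymbol{A}^-=\sum_{k=-l^-}^{r^-}a_k^-\boldsymbol{S}^k$, $\boldsymbol{A}^+=\sum_{k=-l^+}^{r^+}a_k^+\boldsymbol{S}^k$, $\boldsymbol{B}=\sum_{k=-q}^qb_k\boldsymbol{S}^k$. A square matrix is semistable if every eigenvalue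 $\lambda$ satisfies either $\operatorname{Re}\lambda<0$, or $\lambda=0$ and this eigenvalue is regular (semisimple: its algebraic and geometric multiplicities agree). *)

(* Defs.v *)
From mathcomp Require Import all_boot all_order all_algebra.
From mathcomp Require Import reals complex.

Set Implicit Arguments.
Unset Strict Implicit.
Unset Printing Implicit Defensive.

Import Order.TTheory GRing.Theory Num.Theory.
Local Open Scope ring_scope.

(* The integers -l, ..., r in increasing order. *)
Definition stencil (l r : nat) : seq int :=
  [seq i%:Z - l%:Z | i <- iota 0 (l + r).+1].

Section Coefficients.
Variable R : realType.

(* On the stencil l + k and r - k are nonnegative, so the absolute values
   (needed only to land in nat) change nothing there. *)
Definition fd1_coef (l r : nat) (k : int) : R :=
  if k == 0 then - \sum_(j <- stencil l r | j != 0) (j%:~R)^-1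
  else - ((-1) ^ k / k%:~R)
       * ((l`! * r`!)%:R / ((absz (l%:Z + k))`! * (absz (r%:Z - k))`!)%:R).

Definition fd2_coef (q : nat) (k : int) : R :=
  if k == 0 then - \sum_(1 <= j < q.+1) 2 / j%:R ^+ 2
  else - (2 * (-1) ^ k / k%:~R ^+ 2)
       * ((q`! * q`!)%:R / ((absz (q%:Z + k))`! * (absz (q%:Z - k))`!)%:R).

Section Circulant.
Variable n : nat.

(* Acting on column vectors, (S W)_j = W_{j+1} with indices modulo n.+1. *)
Definition shift_mx : 'M[R]_n.+1 := \matrix_(i, j) (j == ordS i)%:R.

(* Negative powers of S are genuine inverses, S being a unit of 'M_n.+1. *)
Definition fd1_mx (l r : nat) : 'M[R]_n.+1 :=
  \sum_(k <- stencil l r) fd1_coef l r k *: shift_mx ^ k.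

Definition fd2_mx (q : nat) : 'M[R]_n.+1 :=
  \sum_(k <- stencil q q) fd2_coef q k *: shift_mx ^ k.

Definition wave_mx (lm rm lp rp q : nat) (rho : R) : 'M[R]_(n.+1 + n.+1) :=
  let Am := fd1_mx lm rm in
  let Ap := fd1_mx lp rp in
  let B := fd2_mx q in
  - 2^-1 *: block_mx (Am - Ap) (Am + Ap) (Am + Ap) (Am - Ap)
  + rho *: block_mx B 0 0 0.

End Circulant.

(* The eigenvalues are the complex ones. The algebraic multiplicity is that of
   the root of the characteristic polynomial; eigenspace is the left (row)
   eigenspace, whose dimension equals that of the right one. *)
Definition semistable (m : nat) (M : 'M[R]_m) : Prop :=
  let MC : 'M[R[i]]_m := map_mx (real_complex R) M in
  forall lam : R[i], eigenvalue MC lam ->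
    complex.Re lam < 0 \/
    lam = 0 /\ mup lam (char_poly MC) = \rank (eigenspace MC lam).

End Coefficients.

(* Main.v *)
Require Import Defs.
From mathcomp Require Import all_boot all_order all_algebra.
From mathcomp Require Import reals complex.
From mathcomp Require Import ring lra zify.

(* With D = 1 - S one has S^T = S^-1, and D is normal.  Comparing coefficients,
   the symmetric part of an upwind operator with stencil (l, r), l - r in
   {1, 2}, is a positive multiple of D^l (D^l)^T, and the downwind operator of
   stencil (l, r) is minus the transpose of the upwind one of stencil (r, l).
   Likewise the second-derivative matrices satisfy
   B_(q+1) = B_q - c D^(q+1) (D^(q+1))^T with c > 0, so that B_q <= 0.  In the
   characteristic variables x + y, x - y the quadratic form of M is therefore
   -1/2 (<A^- (x+y), x+y> - <A^+ (x-y), x-y>) + R <B x, x> <= 0, and it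
   vanishes only when S fixes x and y, in which case M kills (x, y).  A
   dissipative real matrix whose form vanishes only on its kernel has no
   nonzero purely imaginary eigenvalue, and dissipativity alone forbids Jordan
   blocks at 0. *)

Set Implicit Arguments.
Unset Strict Implicit.
Unset Printing Implicit Defensive.

Import Order.TTheory GRing.Theory Num.Theory.
Local Open Scope ring_scope.

(** * Algebraic versus geometric multiplicity of the eigenvalue 0 *)

(** The matrix with blocks [a%:M, C, B, 1%:M] is made block triangular by two different right
    factors. Keeping the powers of [a] avoids dividing by it, so that [a] may be ['X]. *)
Lemma det_scalar_sub_mulmxC (S : comNzRingType) (a : S) m r
    (C : 'M[S]_(m, r)) (B : 'M[S]_(r, m)) :
  \det (a%:M - C *m B) * a ^+ r = a ^+ m * \det (a%:M - B *m C).
Proof.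
have E1 : block_mx a%:M C B 1%:M *m block_mx 1%:M 0 (- B) 1%:M
    = block_mx (a%:M - C *m B) C 0 1%:M.
  by rewrite mulmx_block !mulmx1 !mulmx0 !add0r mul1mx subrr mulmxN.
have E2 : block_mx a%:M C B 1%:M *m block_mx 1%:M (- C) 0 a%:M
    = block_mx a%:M 0 B (a%:M - B *m C).
  rewrite mulmx_block !mulmx1 !mulmx0 !addr0 mul1mx !mulmxN.
  by rewrite mul_scalar_mx mul_mx_scalar addNr addrC.
have := congr1 determinant E1.
rewrite det_mulmx det_lblock det_ublock !det1 !mulr1 => <-.
have := congr1 determinant E2.
by rewrite det_mulmx det_lblock det_ublock !det1 !mul1r !det_scalar.
Qed.

(* Full-rank factorization A = C B turns the claim into B C being invertible,
   since the characteristic polynomials of C B and B C agree up to a power of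
   'X. *)
Lemma mup0_char_poly (F : fieldType) m (A : 'M[F]_m) :
  \rank (A *m A) = \rank A ->
  mup 0 (char_poly A) = \rank (eigenspace A 0).
Proof.
move=> rkA; set r := \rank A.
pose C := col_base A; pose B := row_base A.
have defA : A = C *m B by rewrite mulmx_base.
(* Since [A *m A] is C (B C) B and has rank r, the r x r matrix B C has full rank. *)
have uBC : B *m C \in unitmx.
  rewrite -row_free_unit -row_leq_rank -/r.
  rewrite {1}/r -rkA {1 2}defA mulmxA -[X in X *m B]mulmxA.
  by rewrite (leq_trans (mxrankM_maxl _ _)) // mxrankM_maxr.
have nroot : ~~ root (char_poly (B *m C)) 0.
  rewrite /root horner_coef0 char_poly_det mulf_eq0 signr_eq0 /=.
  by rewrite -unitfE -unitmxE.
have E : char_poly A * 'X^r = 'X^m * char_poly (B *m C).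
  rewrite /char_poly /char_poly_mx {1}defA !map_mxM.
  exact: det_scalar_sub_mulmxC.
have X0 k : ('X^k : {poly F}) != 0 by rewrite -size_poly_gt0 size_polyXn.
have Xmup k : mup 0 ('X^k : {poly F}) = k.
  have /= := @mup_XsubCX F k 0 0.
  by rewrite subr0 eqxx => ->.
have cA0 : char_poly A != 0 by rewrite monic_neq0 ?char_poly_monic.
(* As 0 is not a root of [char_poly (B *m C)], comparing multiplicities at 0 leaves
   [mup 0 (char_poly A) + r = m]. *)
have := congr1 (mup 0) E.
rewrite mupM // mupMl // !Xmup => Em.
by rewrite /eigenspace raddf0 subr0 mxrank_ker -/r -[X in (X - r)%N]Em addnK.
Qed.

(** * The real inner product *)

(** Row vectors are used because [eigenvalue] refers to row eigenvectors. *)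
Definition dotr (R : realType) m (u v : 'rV[R]_m) : R := (u *m v^T) 0 0.

Section Dot.
Variables (R : realType) (m : nat).
Implicit Types (u v w : 'rV[R]_m) (a : R).

Lemma dotrC u v : dotr u v = dotr v u.
Proof. by rewrite /dotr -[in RHS](trmxK v) -trmx_mul [in RHS]mxE. Qed.

Lemma dotrDl u v w : dotr (u + v) w = dotr u w + dotr v w.
Proof. by rewrite /dotr mulmxDl mxE. Qed.

Lemma dotrZl a u v : dotr (a *: u) v = a * dotr u v.
Proof. by rewrite /dotr -scalemxAl mxE. Qed.

Lemma dotrDr u v w : dotr u (v + w) = dotr u v + dotr u w.
Proof. by rewrite dotrC dotrDl !(dotrC u). Qed.

Lemma dotrZr a u v : dotr u (a *: v) = a * dotr u v.
Proof. by rewrite dotrC dotrZl (dotrC u). Qed.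

Lemma dotrNl u v : dotr (- u) v = - dotr u v.
Proof. by rewrite -scaleN1r dotrZl mulN1r. Qed.

Lemma dotrNr u v : dotr u (- v) = - dotr u v.
Proof. by rewrite dotrC dotrNl dotrC. Qed.

Lemma dotr0l u : dotr 0 u = 0.
Proof. by rewrite -(scale0r u) dotrZl mul0r. Qed.

Lemma dotr_ge0 u : 0 <= dotr u u.
Proof. by rewrite /dotr mxE sumr_ge0 // => j _; rewrite mxE -expr2 sqr_ge0. Qed.

Lemma dotr_eq0 u : dotr u u = 0 -> u = 0.
Proof.
rewrite /dotr mxE => /eqP; rewrite psumr_eq0 => [/allP u0|j _]; last first.
  by rewrite mxE -expr2 sqr_ge0.
apply/rowP => j; rewrite mxE; apply/eqP.
by have := u0 j (mem_index_enum j); rewrite mxE -expr2 sqrf_eq0.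
Qed.

End Dot.

Lemma dotr_row_mx (R : realType) m k (u v : 'rV[R]_m) (u' v' : 'rV[R]_k) :
  dotr (row_mx u u') (row_mx v v') = dotr u v + dotr u' v'.
Proof. by rewrite /dotr tr_row_mx mul_row_col mxE. Qed.

Lemma dotr_mulmxl (R : realType) m k (u : 'rV[R]_m) (M : 'M[R]_(m, k)) v :
  dotr (u *m M) v = dotr u (v *m M^T).
Proof. by rewrite /dotr trmx_mul trmxK mulmxA. Qed.

Definition dotrE := (dotrDl, dotrDr, dotrZl, dotrZr, dotrNl, dotrNr).

(** * Semistability from the sign of a quadratic form *)

Lemma semistable_of_quadratic_form (R : realType) m (M : 'M[R]_m) :
  (forall u : 'rV_m, dotr (u *m M) u <= 0) ->
  (forall u : 'rV_m, dotr (u *m M) u = 0 -> u *m M = 0) ->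
  semistable M.
Proof.
move=> Mle0 Meq0 MC lam /eigenvalueP [v vM v0].
pose a : 'rV[R]_m := map_mx (@complex.Re R) v.
pose b : 'rV[R]_m := map_mx (@complex.Im R) v.
have Ere : a *m M = complex.Re lam *: a - complex.Im lam *: b.
  apply/rowP => j; move/rowP/(_ j)/(congr1 (@complex.Re R)): vM.
  rewrite !mxE raddf_sum /=; case: (lam) => s t /=; case: (v 0 j) => p q /= <-.
  apply: eq_bigr => k _; rewrite !mxE /=; case: (v 0 k) => x y /=.
  by rewrite mulr0 subr0.
have Eim : b *m M = complex.Re lam *: b + complex.Im lam *: a.
  apply/rowP => j; move/rowP/(_ j)/(congr1 (@complex.Im R)): vM.
  rewrite !mxE raddf_sum /=; case: (lam) => s t /=; case: (v 0 j) => p q /= <-.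
  apply: eq_bigr => k _; rewrite !mxE /=; case: (v 0 k) => x y /=.
  by rewrite mulr0 add0r.
(* The cross terms in [complex.Im lam] cancel, so the sign of the form is that of the real part of
   [lam]. *)
have Esum : dotr (a *m M) a + dotr (b *m M) b
    = complex.Re lam * (dotr a a + dotr b b).
  by rewrite Ere Eim !dotrE (dotrC b a); ring.
have ab_gt0 : 0 < dotr a a + dotr b b.
  rewrite lt_neqAle addr_ge0 ?dotr_ge0 // andbT eq_sym paddr_eq0 ?dotr_ge0 //.
  apply/negP => /andP [/eqP/dotr_eq0 a0 /eqP/dotr_eq0 b0].
  case/negP: v0; apply/eqP/rowP => j; rewrite mxE.
  move/rowP/(_ j): a0; move/rowP/(_ j): b0; rewrite !mxE.
  by case: (v 0 j) => x y /= -> ->.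
have : complex.Re lam <= 0.
  by rewrite -(pmulr_lle0 _ ab_gt0) -Esum -oppr_ge0 opprD addr_ge0 ?oppr_ge0.
rewrite le_eqVlt => /orP [/eqP re0|]; last by left.
right; rewrite re0 mul0r in Esum.
have aM : a *m M = 0.
  by apply: Meq0; have := Mle0 a; have := Mle0 b; lra.
have bM : b *m M = 0.
  by apply: Meq0; have := Mle0 a; have := Mle0 b; lra.
(* With [a] and [b] in the kernel, a nonzero imaginary part would force a = b = 0. *)
have im0 : complex.Im lam = 0.
  apply/eqP; apply: contraT => im_neq0; move: ab_gt0.
  move: Ere Eim; rewrite aM bM re0 !scale0r sub0r add0r.
  move=> /esym/eqP; rewrite oppr_eq0 scaler_eq0 (negbTE im_neq0) /= => /eqP ->.
  move=> /esym/eqP; rewrite scaler_eq0 (negbTE im_neq0) /= => /eqP ->.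
  by rewrite !dotr0l addr0 ltxx.
have lam0 : lam = 0 by apply/eqP; rewrite eq_complex re0 im0 !eqxx.
split => //; rewrite lam0; apply: mup0_char_poly.
rewrite -map_mxM !mxrank_map.
(* Image and kernel meeting trivially means that M and its square have the same rank, which is what
   [mup0_char_poly] asks for. *)
suff MK0 : (M :&: kermx M)%MS = 0.
  by have := mxrank_mul_ker M M; rewrite MK0 mxrank0 addn0.
apply/eqP/rowV0P => w.
rewrite sub_capmx => /andP [/submxP [u ->]] /sub_kermxP uMM.
set y := u *m M in uMM *; apply: dotr_eq0; set c := dotr y u.
(* The form at [y + e u] equals [e |y|^2 + e^2 <uM, u>]. *)
have seg (e : R) : 0 < e -> dotr y y + e * c <= 0.
  move=> e0; have := Mle0 (y + e *: u).
  rewrite mulmxDl uMM add0r -scalemxAl -/y !dotrE.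
  by rewrite pmulr_rle0 // -/c.
have y_ge0 := dotr_ge0 y; have c_le0 : c <= 0 by apply: Mle0.
apply/eqP; rewrite eq_le y_ge0 andbT leNgt; apply/negP => y_gt0.
(* Take e = |y|^2 / (1 - 2c) in [seg]: clearing the denominator gives |y|^2 (1 - c) <= 0, absurd
   since c <= 0 < |y|^2. *)
have d_gt0 : 0 < 1 - 2 * c by lra.
have := seg _ (divr_gt0 y_gt0 d_gt0).
rewrite -(pmulr_lle0 _ d_gt0) mulrDl mulrAC divfK ?gt_eqF //.
by have := mulr_gt0 y_gt0 d_gt0; have := mulr_ge0 y_ge0 (_ : 0 <= - c); nra.
Qed.

(** * Splitting and reflecting stencil sums *)

Lemma big_stencil (V : nmodType) (l r : nat) (F : int -> V) :
  \sum_(k <- stencil l r) F k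
  = F 0 + \sum_(1 <= j < l.+1) F (- j%:Z) + \sum_(1 <= j < r.+1) F j%:Z.
Proof.
rewrite /stencil big_map -[iota 0 _]/(index_iota 0 (l + r).+1).
have -> : \sum_(0 <= i < (l + r).+1) F (i%:Z - l%:Z)
    = \sum_(0 <= i < l) F (i%:Z - l%:Z) + \sum_(l <= i < (l + r).+1) F (i%:Z - l%:Z).
  by rewrite (big_cat_nat (n := l)) //= leqW ?leq_addr.
have -> : \sum_(l <= i < (l + r).+1) F (i%:Z - l%:Z) = \sum_(0 <= i < r.+1) F i%:Z.
  rewrite -{1}[l]add0n big_addn -addnS addKn.
  by apply: eq_bigr => i _; rewrite PoszD addrK.
rewrite big_nat_rev /= [in RHS]big_add1 [X in _ + X = _]big_ltn //.
rewrite addrCA addrA; congr (_ + _ + _).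
apply: eq_big_nat => i /andP [_ il]; congr F.
by rewrite add0n; lia.
Qed.

Lemma big_stencil_opp (V : nmodType) (l r : nat) (F : int -> V) :
  \sum_(k <- stencil r l) F (- k) = \sum_(k <- stencil l r) F k.
Proof.
rewrite !big_stencil oppr0 addrAC; congr (_ + _ + _).
by apply: eq_bigr => j _; rewrite opprK.
Qed.

(** * The cyclic shift and the difference matrix *)

Section CirculantTheory.
Variables (R : realType) (n : nat).
Local Notation S := (shift_mx R n).

Lemma shift_mx_mulT : S *m S^T = 1.
Proof.
apply/matrixP => i j; rewrite !mxE (bigD1 (ordS i)) //= !mxE eqxx mul1r.
rewrite big1 => [|k ki]; last by rewrite !mxE (negbTE ki) mul0r.
by rewrite addr0 (inj_eq (@ordS_inj _)).
Qed.

Lemma shift_mx_unit : S \is a GRing.unit.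
Proof. by have [] := mulmx1_unit shift_mx_mulT. Qed.

Lemma tr_shift_mx : S^T = S^-1.
Proof.
by apply: (mulrI shift_mx_unit); rewrite divrr ?shift_mx_unit // -shift_mx_mulT.
Qed.

Lemma trmxX (A : 'M[R]_n.+1) j : (A ^+ j)^T = A^T ^+ j.
Proof.
by elim: j => [|j IHj]; rewrite ?trmx1 // exprS exprSr -IHj -!mulmxE trmx_mul.
Qed.

Lemma tr_shift_mxX (k : int) : (S ^ k)^T = S ^ (- k).
Proof.
have E j : (S ^+ j)^T = S ^ (- j%:Z) by rewrite trmxX tr_shift_mx exprVn -exprnN.
by case: k => j; rewrite ?NegzE ?opprK ?E // -E trmxK.
Qed.

Lemma mul_shift_stable (x : 'rV[R]_n.+1) (k : int) : x *m S = x -> x *m S ^ k = x.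
Proof.
move=> xS; have E j : x *m S ^+ j = x.
  by elim: j => [|j IHj]; rewrite ?mulmx1 // exprS -mulmxE mulmxA xS.
case: k => j; first exact: E.
rewrite NegzE -{1}(E j.+1) -exprnN -mulmxA mulmxE.
by rewrite divrr ?mulmx1 ?unitrX ?shift_mx_unit.
Qed.

Local Notation D := (1 - S).

Lemma difference_normal : D * D^T = D^T * D.
Proof.
rewrite linearB /= trmx1 tr_shift_mx; apply: commrB; first exact: commr1.
by apply/commrV/commr_sym/commrB; [exact: commr1 | exact: commr_refl].
Qed.

(** A normal matrix has the same kernel as its powers. The exponent drops by one at a time: if y D D
    = 0, normality gives |y D D^T| = 0, and then |y D| = 0. *)
Lemma mul_diffX_eq0 (x : 'rV[R]_n.+1) l : x *m D ^+ l.+1 = 0 -> x *m D = 0.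
Proof.
elim: l => // l IHl; rewrite 2!exprSr -!mulmxE !mulmxA => xDD; apply: IHl.
rewrite exprSr -mulmxE mulmxA; set y := x *m D ^+ l in xDD *.
have yDDT : y *m D *m D^T = 0.
  apply: dotr_eq0; rewrite dotr_mulmxl trmxK -[_ *m D^T *m D]mulmxA.
  by rewrite !mulmxE -difference_normal -mulmxE mulmxA xDD mul0mx dotrC dotr0l.
by apply: dotr_eq0; rewrite dotr_mulmxl yDDT dotrC dotr0l.
Qed.

(** Since D^T = 1 - S^-1 = - S^-1 D, the left side is (-1)^l S^-l D^(2l), and the binomial theorem
    applies. *)
Lemma diffX_trE l : D ^+ l * D^T ^+ l
  = \sum_(k <- stencil l l) ((-1) ^ k * 'C(l.*2, absz (l%:Z + k))%:R) *: S ^ k.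
Proof.
have SS : GRing.comm (1 : 'M[R]_n.+1) S by exact/commr_sym/commr1.
have -> : D ^+ l * D^T ^+ l = (-1) ^+ l *: (S ^- l * D ^+ (l.*2)).
  rewrite -exprMn_comm; last exact: difference_normal.
  have -> : D * D^T = - (S^-1 * D ^+ 2).
    rewrite difference_normal expr2 mulrA -mulNr; congr (_ * _).
    by rewrite linearB /= trmx1 tr_shift_mx mulrBr mulr1 mulVr ?shift_mx_unit ?opprB.
  rewrite [in LHS]exprNn exprMn_comm; last first.
    apply/commrX/commrB; first exact: commr1.
    exact/commr_sym/commrV/commr_refl.
  rewrite exprVn -exprM mul2n.
  by rewrite -[in LHS]signr_odd -[in RHS]signr_odd mulr_sign scaler_sign.
rewrite /stencil big_map -[iota 0 _]/(index_iota 0 (l + l).+1) addnn big_mkord.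
rewrite exprBn_comm // mulr_sumr scaler_sumr; apply: eq_bigr => i _.
have -> : l%:Z + (i%:Z - l%:Z) = i%:Z by rewrite addrC subrK.
rewrite expr1n mulr1 !exprzDr ?shift_mx_unit ?unitrN1 //.
rewrite -!exprnN -[_ ^- l in RHS]exprVn invrN1 -!exprnP.
rewrite -scaler_nat -[in LHS](signr_odd _ i) mulr_sign -scaler_sign signr_odd.
rewrite -!scalerAr !scalerA; congr (_ *: _); first by ring.
by apply/commrX/commr_sym/commrV/commrX/commr_refl.
Qed.

(** Transposition sends [S ^ k] to [S ^ (- k)], so only the pair of coefficients at -j and j
    matters; the one at j is absent once j exceeds r. *)
Lemma stencil_add_tr (l r : nat) (F : int -> R) : (r <= l)%N ->
  let A := \sum_(k <- stencil l r) F k *: S ^ k in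
  A + A^T = (2 * F 0) *: 1 + \sum_(1 <= j < l.+1)
    (F (- j%:Z) + F j *+ (j <= r)%N) *: (S ^ j + S ^ (- j%:Z)).
Proof.
move=> rl A; pose T k := S ^ k + S ^ (- k).
have -> : A + A^T = \sum_(k <- stencil l r) F k *: T k.
  rewrite /A linear_sum -big_split; apply: eq_bigr => k _ /=.
  by rewrite linearZ /= tr_shift_mxX scalerDr.
rewrite big_stencil -addrA; congr (_ + _).
  by rewrite /T oppr0 expr0z -mulr2n -scaler_nat scalerA mulrC.
rewrite [X in _ + X](_ : _ = \sum_(1 <= j < l.+1) (F j *+ (j <= r)%N) *: T j).
  rewrite -big_split; apply: eq_bigr => j _ /=.
  by rewrite scalerDl /T opprK addrC [S ^ (- _) + _]addrC addrC.
rewrite [RHS](big_cat_nat (n := r.+1)) //= [X in _ + X]big1_seq ?addr0.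
  by apply: eq_big_nat => j /andP [_ jr]; rewrite -ltnS jr mulr1n.
move=> j; rewrite mem_index_iota => /andP [_ /andP [rj _]].
by rewrite leqNgt rj scale0r.
Qed.

End CirculantTheory.

(** * Identities between the finite-difference coefficients *)

Section Coefs.
Variable (R : realType).

Lemma natr_fact_neq0 m : m`!%:R != 0 :> R.
Proof. by rewrite pnatr_eq0 -lt0n fact_gt0. Qed.

Lemma natr_bin_fact m j : (j <= m)%N ->
  'C(m, j)%:R = m`!%:R / (j`!%:R * (m - j)`!%:R) :> R.
Proof.
move=> jm; rewrite -(bin_fact jm) !natrM mulfK //.
by rewrite mulf_neq0 ?natr_fact_neq0.
Qed.

Lemma signzN j : (-1) ^ (- j%:Z) = (-1) ^+ j :> R.
Proof. by rewrite -exprnN -exprVn invrN1. Qed.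

Lemma fd1_coef_pos l r j : (0 < j <= r)%N -> fd1_coef R l r j
  = - ((-1) ^+ j / j%:R) * ((l`!%:R * r`!%:R) / ((l + j)`!%:R * (r - j)`!%:R)).
Proof.
move=> /andP [j0 jr]; rewrite /fd1_coef eqz_nat eqn0Ngt j0 /= subzn //.
by rewrite !natrM.
Qed.

(** The factor 1/k is odd and the two factorials of the denominator trade places. This relates
    downwind to upwind operators. *)
Lemma fd1_coefN l r k : fd1_coef R l r (- k) = - fd1_coef R r l k.
Proof.
rewrite /fd1_coef oppr_eq0; have [_|k0] := eqVneq k 0; last first.
  rewrite opprK -exprz_inv invrN1 !mulrNz invrN mulrN.
  by rewrite opprK mulNr opprK [((absz (l%:Z - k))`! * _)%N]mulnC [(r`! * _)%N]mulnC.
rewrite opprK !(big_mkcond (fun j => j != 0)) !big_stencil /= !add0r.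
rewrite opprD addrC -!sumrN; congr (_ + _); apply: eq_big_nat => j /andP [j0 _];
  by rewrite ?oppr_eq0 eqz_nat eqn0Ngt j0 /= ?mulrNz ?invrN ?opprK.
Qed.

(** A difference of harmonic numbers, which shrinks to one or two terms when l - r is 1 or 2. *)
Lemma fd1_coef0 l r : fd1_coef R l r 0
  = \sum_(1 <= j < l.+1) j%:R^-1 - \sum_(1 <= j < r.+1) j%:R^-1.
Proof.
rewrite /fd1_coef eqxx (big_mkcond (fun j => j != 0)) big_stencil /= add0r.
rewrite opprD -sumrN; congr (_ - _); apply: eq_big_nat => j /andP [j0 _];
  by rewrite ?oppr_eq0 eqz_nat eqn0Ngt j0 /= ?mulrNz ?invrN ?opprK.
Qed.

(* The factor [(j <= r)] discards the junk values of [fd1_coef] off the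
   stencil. *)
Lemma fd1_coef_sym1 r j : (0 < j <= r.+1)%N ->
  fd1_coef R r.+1 r (- j%:Z) + fd1_coef R r.+1 r j *+ (j <= r)%N
  = 2 * (r.+1`!%:R * r`!%:R / (r.+1.*2)`!%:R)
    * ((-1) ^+ j * 'C(r.+1.*2, r.+1 + j)%:R).
Proof.
move=> /andP [j0 jr]; have jn0 : (j%:R : R) != 0 by rewrite pnatr_eq0 -lt0n.
rewrite natr_bin_fact; last by lia.
have -> : (r.+1.*2 - (r.+1 + j) = r.+1 - j)%N by lia.
rewrite fd1_coefN fd1_coef_pos ?j0 //.
move: (_.*2)%N`! (natr_fact_neq0 (r.+1.*2)) => Q F2.
have -> : (r.+1 + j = (r + j).+1)%N by lia.
have rj_neq0 : r%:R + j%:R + 1 != 0 :> R by rewrite -natrD natr1 pnatr_eq0.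
have Frj := natr_fact_neq0 (r + j).
have [jr'|jr'] := leqP j r.
  rewrite mulr1n fd1_coef_pos ?j0 //.
  (* The substitution removes truncated subtraction. With l = r + 1 and common denominator (l+j)!
     (l-j)!, the numerator is (l+j) - (l-j) = 2j, which cancels 1/j. *)
  have [s def_r] : exists s, r = (j + s)%N by exists (r - j)%N; lia.
  have Es : r%:R = j%:R + s%:R :> R by rewrite def_r natrD.
  have -> : (r.+1 + j = (r + j).+1)%N by lia.
  have -> : (r.+1 - j = s.+1)%N by lia.
  have -> : (r - j = s)%N by lia.
  have Fs := natr_fact_neq0 s.
  have s_neq0 : s%:R + 1 != 0 :> R by rewrite natr1 pnatr_eq0.
  rewrite !factS !natrM -!natr1 !natrD Es in rj_neq0 *.
  by field; rewrite F2 Frj Fs jn0 s_neq0 rj_neq0.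
have -> : j = r.+1 by lia.
rewrite subnn mulr0n addr0 !factS !natrM -!natr1 !natrD.
have rr_neq0 : r%:R + (1 + r%:R) + 1 != 0 :> R.
  by rewrite -(natrD _ 1) -natrD natr1 pnatr_eq0.
have r_neq0 : r%:R + 1 != 0 :> R by rewrite natr1 pnatr_eq0.
by field; rewrite F2 natr_fact_neq0 rr_neq0 r_neq0.
Qed.

(** With l = r + 2 and common denominator (l+j)! (l-j)!, the numerator is (l+j)(l+j-1) -
    (l-j)(l-j-1) = 2j(2l-1): the j cancels 1/j and 2l-1 enters the constant. *)
Lemma fd1_coef_sym2 r j : (0 < j <= r.+2)%N ->
  fd1_coef R r.+2 r (- j%:Z) + fd1_coef R r.+2 r j *+ (j <= r)%N
  = 2 * (r.+2.*2.-1)%:R * (r.+2`!%:R * r`!%:R / (r.+2.*2)`!%:R)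
    * ((-1) ^+ j * 'C(r.+2.*2, r.+2 + j)%:R).
Proof.
move=> /andP [j0 jr]; have jn0 : (j%:R : R) != 0 by rewrite pnatr_eq0 -lt0n.
have -> : (r.+2.*2.-1)%:R = 2 * r%:R + 3 :> R.
  by rewrite -natrM -natrD; congr _%:R; lia.
rewrite natr_bin_fact; last by lia.
have -> : (r.+2.*2 - (r.+2 + j) = r.+2 - j)%N by lia.
rewrite fd1_coefN fd1_coef_pos ?j0 //.
move: (_.*2)%N`! (natr_fact_neq0 (r.+2.*2)) => Q F2.
have -> : (r.+2 + j = (r + j).+2)%N by lia.
have rj_neq0 : r%:R + j%:R + 1 != 0 :> R by rewrite -natrD natr1 pnatr_eq0.
have rj1_neq0 : r%:R + j%:R + 1 + 1 != 0 :> R.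
  by rewrite -natrD !natr1 pnatr_eq0.
have Frj := natr_fact_neq0 (r + j).
have [jr'|jr'] := leqP j r.
  rewrite mulr1n fd1_coef_pos ?j0 //.
  have [s def_r] : exists s, r = (j + s)%N by exists (r - j)%N; lia.
  have Es : r%:R = j%:R + s%:R :> R by rewrite def_r natrD.
  have -> : (r.+2 + j = (r + j).+2)%N by lia.
  have -> : (r.+2 - j = s.+2)%N by lia.
  have -> : (r - j = s)%N by lia.
  have Fs := natr_fact_neq0 s.
  have s_neq0 : s%:R + 1 != 0 :> R by rewrite natr1 pnatr_eq0.
  have s1_neq0 : s%:R + 1 + 1 != 0 :> R by rewrite !natr1 pnatr_eq0.
  rewrite !factS !natrM -!natr1 !natrD Es in rj_neq0 rj1_neq0 *.
  by field; rewrite F2 Frj Fs jn0 s_neq0 s1_neq0 rj_neq0 rj1_neq0.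
have Fr := natr_fact_neq0 r.
rewrite mulr0n addr0 !factS !natrM -!natr1 !natrD.
move: (_ + _)%N`! Frj => Z FZ.
(* At j = l-1 and j = l the product (l-j)(l-j-1) is zero, in agreement with the truncated right
   coefficient. *)
have : j = r.+1 \/ j = r.+2 by lia.
case=> def_j; move: rj_neq0 rj1_neq0 jn0; rewrite def_j ?subSnn ?subnn.
  rewrite -!natr1 => rj_neq0 rj1_neq0 jn0.
  by field; rewrite FZ F2 rj_neq0 rj1_neq0.
rewrite -!natr1 => rj_neq0 rj1_neq0 jn0.
by field; rewrite FZ F2 rj_neq0 rj1_neq0.
Qed.

Lemma fd1_coef0_sym1 r : 2 * fd1_coef R r.+1 r 0
  = 2 * (r.+1`!%:R * r`!%:R / (r.+1.*2)`!%:R) * 'C(r.+1.*2, r.+1)%:R.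
Proof.
rewrite natr_bin_fact -?addnn ?leq_addr // addnK fd1_coef0 big_nat_recr //=.
rewrite addrAC subrr add0r.
move: (_ + _)%N`! (natr_fact_neq0 (r.+1 + r.+1)) => Q F2.
have Fr := natr_fact_neq0 r.
rewrite !(factS r) !natrM -!natr1.
have r_neq0 : r%:R + 1 != 0 :> R by rewrite natr1 pnatr_eq0.
by field; rewrite F2 Fr r_neq0.
Qed.

Lemma fd1_coef0_sym2 r : 2 * fd1_coef R r.+2 r 0
  = 2 * (r.+2.*2.-1)%:R * (r.+2`!%:R * r`!%:R / (r.+2.*2)`!%:R)
    * 'C(r.+2.*2, r.+2)%:R.
Proof.
have -> : (r.+2.*2.-1)%:R = 2 * r%:R + 3 :> R.
  by rewrite -natrM -natrD; congr _%:R; lia.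
rewrite natr_bin_fact -?addnn ?leq_addr // addnK fd1_coef0 big_nat_recr //= big_nat_recr //=.
rewrite [X in 2 * X = _]addrC -addrA addKr.
move: (_ + _)%N`! (natr_fact_neq0 (r.+2 + r.+2)) => Q F2.
have Fr := natr_fact_neq0 r.
rewrite !factS !natrM -!natr1.
have r_neq0 : r%:R + 1 != 0 :> R by rewrite natr1 pnatr_eq0.
have r1_neq0 : r%:R + 1 + 1 != 0 :> R by rewrite !natr1 pnatr_eq0.
by field; rewrite F2 Fr r_neq0 r1_neq0.
Qed.

(** One positive constant has to serve the main diagonal and all the others, so that the symmetric
    part is a multiple of a single matrix. *)
Lemma fd1_coef_sym l r : l = r.+1 \/ l = r.+2 ->
  exists2 c : R, 0 < c & 2 * fd1_coef R l r 0 = c * 'C(l.*2, l)%:R /\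
    forall j, (0 < j <= l)%N ->
      fd1_coef R l r (- j%:Z) + fd1_coef R l r j *+ (j <= r)%N
      = c * ((-1) ^+ j * 'C(l.*2, l + j)%:R).
Proof.
case=> ->.
  exists (2 * (r.+1`!%:R * r`!%:R / (r.+1.*2)`!%:R)).
    by rewrite mulr_gt0 // -natrM divr_gt0 // ltr0n ?muln_gt0 ?fact_gt0.
  by split=> [|j jl]; [exact: fd1_coef0_sym1 | exact: fd1_coef_sym1].
exists (2 * (r.+2.*2.-1)%:R * (r.+2`!%:R * r`!%:R / (r.+2.*2)`!%:R)).
  by rewrite -!natrM mulr_gt0 ?divr_gt0 // ltr0n ?muln_gt0 ?fact_gt0.
by split=> [|j jl]; [exact: fd1_coef0_sym2 | exact: fd1_coef_sym2].
Qed.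

Lemma fd2_coef_pos q j : (0 < j <= q)%N -> fd2_coef R q j
  = - (2 * (-1) ^+ j / j%:R ^+ 2)
    * ((q`!%:R * q`!%:R) / ((q + j)`!%:R * (q - j)`!%:R)).
Proof.
move=> /andP [j0 jr]; rewrite /fd2_coef eqz_nat eqn0Ngt j0 /= subzn //.
by rewrite !natrM.
Qed.

Lemma fd2_coefN q k : fd2_coef R q (- k) = fd2_coef R q k.
Proof.
rewrite /fd2_coef oppr_eq0; have [//|k0] := eqVneq k 0.
by rewrite opprK -exprz_inv invrN1 mulrNz sqrrN [((absz (q%:Z - k))`! * _)%N]mulnC.
Qed.

(** Over the common denominator (q+1+j)! (q+1-j)! the numerator is (q+1)^2 - (q+1+j)(q+1-j) = j^2,
    which cancels 1/j^2. *)
Lemma fd2_coef_step q j : (0 < j <= q.+1)%N ->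
  fd2_coef R q.+1 j - fd2_coef R q j *+ (j <= q)%N
  = - (2 * (q`!%:R ^+ 2 / (q.+1.*2)`!%:R))
    * ((-1) ^+ j * 'C(q.+1.*2, q.+1 + j)%:R).
Proof.
move=> /andP [j0 jq]; have jn0 : (j%:R : R) != 0 by rewrite pnatr_eq0 -lt0n.
rewrite natr_bin_fact; last by lia.
have -> : (q.+1.*2 - (q.+1 + j) = q.+1 - j)%N by lia.
rewrite fd2_coef_pos ?j0 //.
move: (_.*2)%N`! (natr_fact_neq0 (q.+1.*2)) => Q F2.
have -> : (q.+1 + j = (q + j).+1)%N by lia.
have qj_neq0 : q%:R + j%:R + 1 != 0 :> R by rewrite -natrD natr1 pnatr_eq0.
have Fqj := natr_fact_neq0 (q + j).
have [jq'|jq'] := leqP j q.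
  rewrite mulr1n fd2_coef_pos ?j0 //.
  have [s def_q] : exists s, q = (j + s)%N by exists (q - j)%N; lia.
  have Es : q%:R = j%:R + s%:R :> R by rewrite def_q natrD.
  have -> : (q.+1 - j = s.+1)%N by lia.
  have -> : (q - j = s)%N by lia.
  have Fs := natr_fact_neq0 s.
  have s_neq0 : s%:R + 1 != 0 :> R by rewrite natr1 pnatr_eq0.
  rewrite !factS !natrM -!natr1 !natrD Es in qj_neq0 *.
  by field; rewrite F2 Fqj Fs jn0 s_neq0 qj_neq0.
have def_j : j = q.+1 by lia.
rewrite mulr0n subr0 !factS !natrM -!natr1 !natrD.
move: (_ + _)%N`! Fqj => Z FZ; move: qj_neq0 jn0; rewrite def_j subnn -!natr1.
by move=> qj_neq0 jn0; field; rewrite FZ F2 qj_neq0 jn0.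
Qed.

Lemma fd2_coef0_step q : fd2_coef R q.+1 0 - fd2_coef R q 0
  = - (2 * (q`!%:R ^+ 2 / (q.+1.*2)`!%:R)) * 'C(q.+1.*2, q.+1)%:R.
Proof.
rewrite natr_bin_fact -?addnn ?leq_addr // addnK /fd2_coef eqxx.
rewrite big_nat_recr //= opprD opprK [X in X = _]addrC addNKr.
move: (_ + _)%N`! (natr_fact_neq0 (q.+1 + q.+1)) => Q F2.
have Fq := natr_fact_neq0 q.
have q_neq0 : q%:R + 1 != 0 :> R by rewrite natr1 pnatr_eq0.
by rewrite factS natrM -(natr1 q); field; rewrite F2 Fq q_neq0.
Qed.

End Coefs.

(** * Definiteness and kernels of the difference operators *)

Section Operators.
Variables (R : realType) (n : nat).
Local Notation S := (shift_mx R n).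
Local Notation D := (1 - S).

(** The matrix E = D^l (D^l)^T is symmetric, so 2E = E + E^T; after doubling, [stencil_add_tr]
    expands both sides in the same symmetric circulants and coefficients are compared. *)
Lemma stencil_sym_part (l r : nat) (F : int -> R) (c : R) : (r <= l)%N ->
  2 * F 0 = c * 'C(l.*2, l)%:R ->
  (forall j, (0 < j <= l)%N ->
     F (- j%:Z) + F j *+ (j <= r)%N = c * ((-1) ^+ j * 'C(l.*2, l + j)%:R)) ->
  let A := \sum_(k <- stencil l r) F k *: S ^ k in
  A + A^T = c *: (D ^+ l * D^T ^+ l).
Proof.
move=> rl F0 Fj A.
set E := D ^+ l * D^T ^+ l.
have ET : E^T = E by rewrite /E -mulmxE trmx_mul !trmxX trmxK.
pose e k : R := (-1) ^ k * 'C(l.*2, absz (l%:Z + k))%:R.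
have E2 := stencil_add_tr n e (leqnn l); cbv zeta in E2.
rewrite -(_ : E = \sum_(k <- stencil l l) e k *: S ^ k) ?ET in E2; last first.
  exact: diffX_trE.
apply: (scalerI (_ : 2 != 0 :> R)); first by rewrite pnatr_eq0.
rewrite [in RHS]scalerA [2 * c]mulrC -scalerA [2 *: E]scaler_nat [E *+ 2]mulr2n.
rewrite E2.
rewrite (stencil_add_tr n F rl) !scalerDr !scalerA F0; congr (_ *: _ + _).
  by rewrite /e addr0 expr0z mul1r absz_nat; ring.
rewrite !scaler_sumr; apply: eq_big_nat => j /andP [j0]; rewrite ltnS => jl.
rewrite Fj ?j0 // jl mulr1n !scalerA /e signzN; congr (_ *: _).
rewrite -exprnP subzn // -PoszD !absz_nat.
have -> : 'C(l.*2, l - j) = 'C(l.*2, l + j).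
  by rewrite -bin_sub; [congr 'C(_, _)|]; lia.
ring.
Qed.

Lemma stable_mul_tr (x : 'rV[R]_n.+1) l r (F : int -> R) : x *m S = x ->
  let A := \sum_(k <- stencil l r) F k *: S ^ k in x *m A^T = x *m A.
Proof.
move=> xS A; rewrite /A linear_sum !mulmx_sumr; apply: eq_bigr => k _ /=.
by rewrite linearZ /= tr_shift_mxX -!scalemxAr !mul_shift_stable.
Qed.

Lemma diff_eq0_stable (x : 'rV[R]_n.+1) : x *m D = 0 -> x *m S = x.
Proof. by rewrite mulmxBr mulmx1 => /eqP; rewrite subr_eq0 => /eqP. Qed.

Lemma dotr_sym_part (x : 'rV[R]_n.+1) (A : 'M[R]_n.+1) :
  2 * dotr (x *m A) x = dotr (x *m (A + A^T)) x.
Proof.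
by rewrite mulmxDr dotrDl [dotr (x *m A^T) x]dotr_mulmxl trmxK [dotr x _]dotrC; ring.
Qed.

Lemma dotr_diffX (x : 'rV[R]_n.+1) c l :
  dotr (x *m (c *: (D ^+ l * D^T ^+ l))) x
  = c * dotr (x *m D ^+ l) (x *m D ^+ l).
Proof.
by rewrite -scalemxAr dotrZl -mulmxE mulmxA [in LHS]dotr_mulmxl trmxX trmxK.
Qed.

Lemma stable_diffX_eq0 (x : 'rV[R]_n.+1) c l : x *m S = x -> (0 < l)%N ->
  x *m (c *: (D ^+ l * D^T ^+ l)) = 0.
Proof.
move=> xS; case: l => // l _; rewrite -scalemxAr exprS -!mulmxE !mulmxA.
by rewrite mulmxBr mulmx1 xS subrr !mul0mx scaler0.
Qed.

(** Twice the form is c |x D^l|^2 with c > 0; in the equality case [mul_diffX_eq0] brings the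
    exponent down to 1. *)
Lemma fd1_mx_ge0 l r (x : 'rV[R]_n.+1) : l = r.+1 \/ l = r.+2 ->
  0 <= dotr (x *m fd1_mx R n l r) x
    ?= iff (x *m D == 0).
Proof.
move=> lr; have [c c0 [F0 Fj]] := fd1_coef_sym R lr.
have rl : (r <= l)%N by case: lr => ->; lia.
have E := stencil_sym_part rl F0 Fj; rewrite -/(fd1_mx R n l r) /= in E.
have E2 := dotr_sym_part x (fd1_mx R n l r); rewrite E dotr_diffX in E2.
have l0 : (0 < l)%N by case: lr => ->.
split.
  by rewrite -(pmulr_rge0 _ (ltr0Sn R 1)) E2 mulr_ge0 ?dotr_ge0 // ltW.
apply/eqP/eqP => [Q0|xD].
  case: l {lr F0 Fj rl E} l0 E2 Q0 => // l _ E2 Q0.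
  apply/(@mul_diffX_eq0 _ _ _ l)/dotr_eq0/eqP.
  by move/eqP: E2; rewrite -Q0 mulr0 eq_sym mulf_eq0 gt_eqF.
apply/esym/eqP; have /eqP := E2; case: l l0 {lr F0 Fj rl E E2} => // l _.
by rewrite exprS -mulmxE mulmxA xD mul0mx dotr0l mulr0 mulf_eq0 pnatr_eq0.
Qed.

(** On a shift-invariant x the operator and its transpose agree, so twice x A is a multiple of x D^l
    (D^l)^T = 0. No summation of the coefficients is required. *)
Lemma stable_fd1_mx l r (x : 'rV[R]_n.+1) : l = r.+1 \/ l = r.+2 ->
  x *m S = x -> x *m fd1_mx R n l r = 0.
Proof.
move=> lr xS; have [c c0 [F0 Fj]] := fd1_coef_sym R lr.
have rl : (r <= l)%N by case: lr => ->; lia.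
have l0 : (0 < l)%N by case: lr => ->.
have := congr1 (mulmx x) (stencil_sym_part rl F0 Fj).
rewrite stable_diffX_eq0 // mulmxDr stable_mul_tr // -mulr2n => /eqP.
by rewrite -scaler_nat scaler_eq0 pnatr_eq0 => /eqP.
Qed.

Lemma fd1_mx_tr l r : fd1_mx R n l r = - (fd1_mx R n r l)^T.
Proof.
rewrite /fd1_mx -big_stencil_opp linear_sum -sumrN; apply: eq_bigr => k _ /=.
by rewrite linearZ /= tr_shift_mxX -scaleNr -fd1_coefN.
Qed.

Lemma fd2_mx_step q : exists2 c : R, 0 < c &
  fd2_mx R n q.+1 + (fd2_mx R n q.+1)^T
  = fd2_mx R n q + (fd2_mx R n q)^T - c *: (D ^+ q.+1 * D^T ^+ q.+1).
Proof.
(* Twice the constant of [fd2_coef_step]: the increment is even in k, so the entries at -j and j add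
   up to double. *)
exists (2 * (2 * (q`!%:R ^+ 2 / (q.+1.*2)`!%:R))).
  by rewrite !mulr_gt0 ?invr_gt0 ?exprn_gt0 ?ltr0n ?fact_gt0.
(* [fd2_coef R q] takes junk values off its stencil, hence the truncation. *)
pose t k : R := fd2_coef R q k *+ (absz k <= q)%N.
have Et : fd2_mx R n q = \sum_(k <- stencil q.+1 q.+1) t k *: S ^ k.
  rewrite /fd2_mx !big_stencil [X in _ = _ + X + _]big_nat_recr //=.
  rewrite [X in _ = _ + X]big_nat_recr //= /t abszN !absz_nat ltnn !scale0r !addr0.
  by congr (_ + _ + _); apply: eq_big_nat => j /andP [_ jq];
    rewrite ?abszN absz_nat -ltnS jq.
pose d k := fd2_coef R q.+1 k - t k.
have Ed : fd2_mx R n q.+1 - fd2_mx R n q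
    = \sum_(k <- stencil q.+1 q.+1) d k *: S ^ k.
  by rewrite Et -sumrB; apply: eq_bigr => k _; rewrite scalerBl.
set c := 2 * (2 * _).
have d0 : 2 * d 0 = - c * 'C(q.+1.*2, q.+1)%:R.
  by rewrite /d /t absz0 mulr1n fd2_coef0_step /c; ring.
have dj j : (0 < j <= q.+1)%N -> d (- j%:Z) + d j *+ (j <= q.+1)%N
    = - c * ((-1) ^+ j * 'C(q.+1.*2, q.+1 + j)%:R).
  move=> jq; have /andP [_ ->] := jq.
  rewrite /d /t !fd2_coefN abszN absz_nat mulr1n fd2_coef_step // /c; ring.
have := stencil_sym_part (leqnn _) d0 dj; rewrite /= -Ed linearB /= scaleNr => <-.
by rewrite [RHS]addrACA ![_ + (_ - _)]addrC !subrK.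
Qed.

(** Induction on q, starting from the zero matrix at q = 0. Each step subtracts a positive multiple
    of D^(q+1) (D^(q+1))^T, which is nonnegative and kills shift-invariant vectors. *)
Lemma fd2_mx_le0 q (x : 'rV[R]_n.+1) :
  dotr (x *m fd2_mx R n q) x <= 0 /\ (x *m S = x -> x *m fd2_mx R n q = 0).
Proof.
have two_gt0 : (0 : R) < 2 by [].
suff [Qle0 Qst] : dotr (x *m (fd2_mx R n q + (fd2_mx R n q)^T)) x <= 0 /\
    (x *m S = x -> x *m (fd2_mx R n q + (fd2_mx R n q)^T) = 0).
  split=> [|xS]; first by rewrite -(pmulr_rle0 _ two_gt0) dotr_sym_part.
  have /eqP := Qst xS; rewrite mulmxDr stable_mul_tr // -mulr2n.
  by rewrite -scaler_nat scaler_eq0 pnatr_eq0 => /eqP.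
elim: q => [|q [IHle IHst]].
  rewrite /fd2_mx big_stencil !big_geq // !addr0 /fd2_coef eqxx big_geq //.
  by rewrite oppr0 scale0r trmx0 addr0 mulmx0 dotr0l.
have [c c0 ->] := fd2_mx_step q; split.
  rewrite mulmxBr dotrDl dotrNl dotr_diffX.
  by have := mulr_ge0 (ltW c0) (dotr_ge0 (x *m D ^+ q.+1)); lra.
by move=> xS; rewrite mulmxBr IHst // stable_diffX_eq0 // subrr.
Qed.

End Operators.

(** * The wave matrix in characteristic variables *)

Theorem theorem5p2 (R : realType) (n lm rm lp rp q : nat)
    (hm : lm = (rm + 1)%N \/ lm = (rm + 2)%N)
    (hp : rp = (lp + 1)%N \/ rp = (lp + 2)%N)
    (hq : (1 <= q)%N) (rho : R) (hrho : 0 < rho) :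
  semistable (wave_mx n lm rm lp rp q rho).
Proof.
rewrite addn1 addn2 in hm; rewrite addn1 addn2 in hp.
have form (x y : 'rV[R]_n.+1) :
    dotr (row_mx x y *m wave_mx n lm rm lp rp q rho) (row_mx x y)
    = - 2^-1 * (dotr ((x + y) *m fd1_mx R n lm rm) (x + y)
                + dotr ((x - y) *m fd1_mx R n rp lp) (x - y))
      + rho * dotr (x *m fd2_mx R n q) x.
  (* Replacing the downwind operator by minus the transpose of the upwind [F] gives both
     first-derivative terms the sign treated by [fd1_mx_ge0]. *)
  rewrite /wave_mx [fd1_mx R n lp rp]fd1_mx_tr.
  set P := fd1_mx R n lm rm; set F := fd1_mx R n rp lp; set B := fd2_mx R n q.
  have trF u v : dotr (u *m F^T) v = dotr (v *m F) u.
    by rewrite dotr_mulmxl trmxK dotrC.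
  rewrite mulmxDr -!scalemxAr !mul_row_block !mulmx0 !addr0.
  rewrite dotrDl !dotrZl !dotr_row_mx dotr0l.
  rewrite !(mulmxDl, mulmxBl, mulmxDr, mulmxN, mulNmx, opprK, dotrE, trF); ring.
have half_lt0 : - 2^-1 < 0 :> R by rewrite oppr_lt0 invr_gt0.
apply: semistable_of_quadratic_form => u; rewrite -[u]hsubmxK.
  set x := lsubmx u; set y := rsubmx u; rewrite form.
  have [Am_ge0 _] := fd1_mx_ge0 (x + y) hm; have [Ap_ge0 _] := fd1_mx_ge0 (x - y) hp.
  have [B_le0 _] := fd2_mx_le0 q x.
  have := mulr_ge0 (ltW hrho) (_ : 0 <= - dotr (x *m fd2_mx R n q) x); lra.
set x := lsubmx u; set y := rsubmx u; rewrite form => form0.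
have [Am_ge0 Am_eq0] := fd1_mx_ge0 (x + y) hm.
have [Ap_ge0 Ap_eq0] := fd1_mx_ge0 (x - y) hp.
have [B_le0 stB] := fd2_mx_le0 q x.
have rB_ge0 : 0 <= - (rho * dotr (x *m fd2_mx R n q) x).
  by rewrite -mulrN mulr_ge0 ?oppr_ge0 // ltW.
(* A vanishing sum of three nonpositive terms has all terms zero, so the equality cases of
   [fd1_mx_ge0] apply to x + y and x - y. *)
have Sxy : (x + y) *m shift_mx R n = x + y.
  by apply/diff_eq0_stable/eqP; rewrite -Am_eq0; apply/eqP; lra.
have Sx'y : (x - y) *m shift_mx R n = x - y.
  by apply/diff_eq0_stable/eqP; rewrite -Ap_eq0; apply/eqP; lra.
have two_neq0 : (2 : R) != 0 by rewrite pnatr_eq0.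
have Sx : x *m shift_mx R n = x.
  apply: (scalerI two_neq0); rewrite scalemxAl.
  rewrite (_ : 2 *: x = (x + y) + (x - y)) 1?mulmxDl ?Sxy ?Sx'y //.
  by rewrite addrACA subrr addr0 scaler_nat.
have Sy : y *m shift_mx R n = y.
  by move: Sxy; rewrite mulmxDl Sx => /addrI.
have stP (u' : 'rV_n.+1) : u' *m shift_mx R n = u' -> u' *m fd1_mx R n lm rm = 0.
  exact: stable_fd1_mx hm.
have stF (u' : 'rV_n.+1) : u' *m shift_mx R n = u' -> u' *m fd1_mx R n lp rp = 0.
  move=> Su'; rewrite fd1_mx_tr mulmxN stable_mul_tr //.
  by rewrite -/(fd1_mx R n rp lp) (stable_fd1_mx hp Su') oppr0.
rewrite /wave_mx mulmxDr -!scalemxAr !mul_row_block !mulmxDr !mulmxN.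
by rewrite !stP // !stF // stB // !mulmx0 !(oppr0, addr0) row_mx0 !scaler0 addr0.
Qed.
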